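(* Let $L$ and $M$ be completely distributive lattices such that $\beta(a\wedge b)=\beta(a)\cap\beta(b)$ for all $a,b\in L$. Let $(X,\mathscr{C})$ be an $M$-fuzzifying convex structure. Define $\omega(\mathscr{C}):L^X\to M$ by $$\omega(\mathscr{C})(A)=\bigwedge_{a\in L}\mathscr{C}(A_{[a]})\qquad\text{for all }A\in L^X.$$ Then $\omega(\mathscr{C})$ is an $(L,M)$-fuzzy convexity on $X$.
   Context: For $a,b\in L$, $a\prec b$ means that for every subset $D\subseteq L$ with $b\le\sup D$ there is $d\in D$ with $a\le d$; $\beta(b)=\{a\in L: a\prec b\}$. $X$ is a nonempty set; $L^X$ is the set of all functions $X\to L$ with the pointwise order, with least element $\chi_\emptyset$ and greatest element $\chi_X$. For $A\in L^X$ and $a\in L$, $A_{[a]}=\{x\in X: a\le A(x)\}$. An $M$-fuzzifying convexity on $X$ is a map $\mathscr{C}:\mathbf{2}^X\to M$ ($\mathbf{2}^X$ the power set) with: (1) $\mathscr{C}(\emptyset)=\mathscr{C}(X)=\top_M$; (2) $\mathscr{C}(\bigcap_{i}A_i)\ge\bigwedge_i\mathscr{C}(A_i)$ for every nonempty family of subsets of $X$; (3) $\mathscr{C}(\bigcup_i A_i)\ge\bigwedge_i\mathscr{C}(A_i)$ for every nonempty family of subsets totally ordered by inclusion. Then $(X,\mathscr{C})$ is an $M$-fuzzifying convex structure. An $(L,M)$-fuzzy convexity on $X$ is a map $\mathcal{C}:L^X\to M$ with: (LMC1) $\mathcal{C}(\chi_\emptyset)=\mathcal{C}(\chi_X)=\top_M$;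 (LMC2) $\mathcal{C}(\bigwedge_i A_i)\ge\bigwedge_i\mathcal{C}(A_i)$ for every nonempty family in $L^X$; (LMC3) $\mathcal{C}(\bigvee_i A_i)\ge\bigwedge_i\mathcal{C}(A_i)$ for every nonempty family in $L^X$ totally ordered by $\le$. *)

(* Defs.v *)
From mathcomp Require Import all_boot all_order.
From mathcomp Require Import boolp classical_sets.

Set Implicit Arguments.
Unset Strict Implicit.
Unset Printing Implicit Defensive.

Import Order.TTheory.

Local Open Scope classical_set_scope.
Local Open Scope order_scope.

Reserved Notation "\Sup_ i F"
  (at level 41, F at level 41, i at level 0, format "'[' \Sup_ i '/  '  F ']'").
Reserved Notation "\Inf_ i F"
  (at level 41, F at level 41, i at level 0, format "'[' \Inf_ i '/  '  F ']'").

(* The first argument of [supremum] (resp. [infimum]) is its value on the empty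
   set, so in a complete lattice [csup] and [cinf] are the actual supremum and
   infimum of every subset, including the empty one. *)
Definition csup d (L : tbLatticeType d) (S : set L) : L := supremum \bot S.
Definition cinf d (L : tbLatticeType d) (S : set L) : L := infimum \top S.

Notation "\Sup_ i F" := (csup (range (fun i => F))) : order_scope.
Notation "\Inf_ i F" := (cinf (range (fun i => F))) : order_scope.

Definition complete_lattice d (L : tbLatticeType d) : Prop :=
  forall S : set L, supremums S !=set0 /\ infimums S !=set0.

Definition completely_distributive d (L : tbLatticeType d) : Prop :=
  complete_lattice L /\
  forall (I : Type) (J : I -> Type) (a : forall i, J i -> L),
    \Inf_i \Sup_j a i j = \Sup_f \Inf_i a i (f i).

Definition prec d (L : tbLatticeType d) (a b : L) : Prop :=
  forall D : set L, b <= csup D -> exists2 e, D e & a <= e.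

Definition beta d (L : tbLatticeType d) (b : L) : set L := [set a | prec a b].

Definition cut (X : Type) d (L : tbLatticeType d) (A : X -> L) (a : L) : set X :=
  [set x | a <= A x].

Record fuzzifying_convexity (X : Type) d (M : tbLatticeType d)
    (C : set X -> M) : Prop := {
  fuzzifying_convexity0 : C set0 = \top;
  fuzzifying_convexityT : C setT = \top;
  fuzzifying_convexity_bigcap (I : Type) (A : I -> set X) : inhabited I ->
    \Inf_i C (A i) <= C (\bigcap_i A i);
  fuzzifying_convexity_bigcup (I : Type) (A : I -> set X) : inhabited I ->
    total_on (range A) subset ->
    \Inf_i C (A i) <= C (\bigcup_i A i)
}.

(* Infima and suprema in [X -> L] are written pointwise; [fun_infimums] and
   [fun_supremums] below show that they are those of the pointwise order. *)
Record fuzzy_convexity (X : Type) d d' (L : tbLatticeType d)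
    (M : tbLatticeType d') (C : (X -> L) -> M) : Prop := {
  fuzzy_convexity_bot : C (fun=> \bot) = \top;
  fuzzy_convexity_top : C (fun=> \top) = \top;
  fuzzy_convexity_inf (I : Type) (A : I -> X -> L) : inhabited I ->
    \Inf_i C (A i) <= C (fun x => \Inf_i A i x);
  fuzzy_convexity_sup (I : Type) (A : I -> X -> L) : inhabited I ->
    total_on (range A) (fun B B' => B <= B') ->
    \Inf_i C (A i) <= C (fun x => \Sup_i A i x)
}.

Definition omega (X : Type) d d' (L : tbLatticeType d) (M : tbLatticeType d')
    (C : set X -> M) (A : X -> L) : M :=
  \Inf_a C (cut A a).

Lemma csupP d (L : tbLatticeType d) (S : set L) :
  complete_lattice L -> supremums S (csup S).
Proof.
move=> /(_ S)[[s Ss] _]; rewrite /csup /supremum; case: ifPn => [/eqP S0|_].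
  by split => [x|x _]; [rewrite S0|exact: le0x].
exact: (xgetPex \bot (ex_intro _ s Ss)).
Qed.

Lemma cinfP d (L : tbLatticeType d) (S : set L) :
  complete_lattice L -> infimums S (cinf S).
Proof.
move=> /(_ S)[_ [s Ss]]; rewrite /cinf /infimum; case: ifPn => [/eqP S0|_].
  by split => [x|x _]; [rewrite S0|exact: lex1].
exact: (xgetPex \top (ex_intro _ s Ss)).
Qed.

Lemma fun_supremums (X I : Type) d (L : tbLatticeType d) (A : I -> X -> L) :
  complete_lattice L -> supremums (range A) (fun x => \Sup_i A i x).
Proof.
move=> cL; split => [_ [i _ <-]|B ubB]; apply/lefP => x.
  by apply: (proj1 (csupP _ cL)); exists i.
apply: (proj2 (csupP _ cL)) => _ [i _ <-].
by apply: (lefP _ _ (ubB (A i) _)); exists i.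
Qed.

Lemma fun_infimums (X I : Type) d (L : tbLatticeType d) (A : I -> X -> L) :
  complete_lattice L -> infimums (range A) (fun x => \Inf_i A i x).
Proof.
move=> cL; split => [_ [i _ <-]|B lbB]; apply/lefP => x.
  by apply: (proj1 (cinfP _ cL)); exists i.
apply: (proj2 (cinfP _ cL)) => _ [i _ <-].
by apply: (lefP _ _ (lbB (A i) _)); exists i.
Qed.

(* Main.v *)
Require Import Defs.
From mathcomp Require Import all_boot all_order.
From mathcomp Require Import boolp classical_sets.

(** The level sets of [omega C] commute with infima, so closure under infima is
closure of [C] under intersections, level by level. Level sets do not commute
with suprema, even of chains: [a <= \Sup_i A i x] need not make [a] lie below a
single [A i x]. It does so for every [b] in [beta a], however, and in a
completely distributive lattice [a] is the supremum of [beta a]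
([csup_beta]). Hence the [a]-cut of a supremum is the intersection, over
[b] in [beta a], of the unions of the [b]-cuts ([cut_csup]). When the [A i]
form a chain so do their [b]-cuts, and the two closure properties of [C]
bound the degree of the [a]-cut from below. *)

Local Open Scope classical_set_scope.
Local Open Scope order_scope.

Import Order.TTheory.

Section CompleteLattice.
Context {d : Order.disp_t} {L : tbLatticeType d} (cL : complete_lattice L).

Lemma csup_ub (S : set L) x : S x -> x <= csup S.
Proof. exact: (proj1 (csupP S cL)). Qed.

Lemma csup_least (S : set L) b : (forall x, S x -> x <= b) -> csup S <= b.
Proof. by move=> Sb; apply: (proj2 (csupP S cL)). Qed.

Lemma Inf_lb (I : Type) (F : I -> L) i : \Inf_i F i <= F i.
Proof. by apply: (proj1 (cinfP _ cL)); exists i. Qed.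

Lemma Inf_greatest (I : Type) (F : I -> L) b :
  (forall i, b <= F i) -> b <= \Inf_i F i.
Proof. by move=> bF; apply: (proj2 (cinfP _ cL)) => _ [i _ <-]. Qed.

End CompleteLattice.

(** Apply complete distributivity to the family of all sets [D] whose supremum
is above [a]: the infimum of their suprema is above [a], and a choice function
[f] picking one element in each [D] has an infimum in [beta a], since that
infimum is below the element [f] picks in [D]. *)
Lemma csup_beta d (L : tbLatticeType d) (a : L) :
  completely_distributive L -> a <= csup (beta a).
Proof.
move=> [cL distrL].
pose I := {D : set L | a <= csup D}; pose J (D : I) := {e | sval D e}.
have := distrL I J (fun D e => sval e).
set lhs := cinf _; set rhs := csup _ => lr.
apply: (@le_trans _ _ lhs).
  apply: Inf_greatest => // -[D aD] /=; apply: (le_trans aD).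
  apply: csup_least => // e De; apply: csup_ub => //.
  by exists (exist _ e De).
rewrite lr; apply: csup_least => // _ [f _ <-].
apply: csup_ub => // D aD.
exists (sval (f (exist _ D aD))); first by case: (f _).
exact: (Inf_lb cL _ (fun D => sval (f D))).
Qed.

Lemma cut_cinf (X I : Type) d (L : tbLatticeType d) (A : I -> X -> L) (a : L) :
  complete_lattice L ->
  cut (fun x => \Inf_i A i x) a = \bigcap_i cut (A i) a.
Proof.
move=> cL; apply/seteqP; split => x /= ax.
  by move=> i _; apply: (le_trans ax); apply: (Inf_lb cL _ (A^~ x)).
by apply: Inf_greatest => // i; apply: ax.
Qed.

(** The left-to-right inclusion is the definition of [beta a] applied to the
supremum at [x]; the converse holds because [a] is the supremum of [beta a]. *)
Lemma cut_csup (X I : Type) d (L : tbLatticeType d) (A : I -> X -> L) (a : L) :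
  completely_distributive L ->
  cut (fun x => \Sup_i A i x) a =
  \bigcap_(b : {b | beta a b}) \bigcup_i cut (A i) (sval b).
Proof.
move=> cdL; have cL := cdL.1; apply/seteqP; split => x /= ax.
  by move=> [b ab] _; have [_ [i _ <-] bi] := ab _ ax; exists i.
apply: (le_trans (csup_beta _ _ a cdL)); apply: csup_least => // b ab.
have [i _ bi] := ax (exist _ b ab) Logic.I; apply: (le_trans bi).
by apply: csup_ub => //; exists i.
Qed.

Theorem theorem6p2 (d d' : Order.disp_t) (L : tbLatticeType d)
    (M : tbLatticeType d') (X : Type) (C : set X -> M) :
  completely_distributive L ->
  completely_distributive M ->
  (forall a b : L, beta (a `&` b)%O = (beta a `&` beta b)%classic) ->
  inhabited X ->
  fuzzifying_convexity C ->
  fuzzy_convexity (omega C : (X -> L) -> M).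
Proof.
move=> cdL [cM _] _ _ [C0 CT Ccap Ccup]; have cL := cdL.1.
have omega_le (I : Type) (A : I -> X -> L) a i :
    \Inf_i omega C (A i) <= C (cut (A i) a).
  apply: (le_trans (Inf_lb cM _ _ i)).
  exact: (Inf_lb cM _ (fun a => C (cut (A i) a))).
split.
- apply/eqP; rewrite -le1x; apply: Inf_greatest => // a.
  have [->|a0] := eqVneq a \bot.
    suff -> : cut (fun _ : X => \bot : L) \bot = setT by rewrite CT.
    by apply/seteqP; split => x //= _; rewrite /cut /=.
  suff -> : cut (fun _ : X => \bot : L) a = set0 by rewrite C0.
  by apply/seteqP; split => x //=; rewrite /cut /= lex0 (negbTE a0).
- apply/eqP; rewrite -le1x; apply: Inf_greatest => // a.
  suff -> : cut (fun _ : X => \top : L) a = setT by rewrite CT.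
  by apply/seteqP; split => x //= _; apply: lex1.
- move=> I A I0; apply: Inf_greatest => // a; rewrite cut_cinf //.
  apply: le_trans (Ccap _ _ I0); apply: Inf_greatest => //.
- move=> I A I0 chainA; apply: Inf_greatest => // a; rewrite cut_csup //.
  have [B0|noB] := pselect (inhabited {b | beta a b}); last first.
    (* the closure property of [C] needs a nonempty family; an empty
       intersection is the whole of [X] *)
    suff -> : \bigcap_(b : {b | beta a b}) \bigcup_i cut (A i) (sval b) = setT.
      by rewrite CT lex1.
    by apply/seteqP; split => x // _ b; case: noB.
  apply: le_trans (Ccap _ _ B0); apply: Inf_greatest => // -[b _] /=.
  apply: le_trans (Ccup _ (fun i => cut (A i) b) I0 _).
    by apply: Inf_greatest => // i; apply: omega_le.
  have mono i j : A i <= A j -> cut (A i) b `<=` cut (A j) b.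
    by move=> /lefP ij x /= bi; apply: le_trans bi (ij x).
  move=> _ _ [i _ <-] [j _ <-].
  have [] := chainA (A i) (A j); [by exists i|by exists j| |].
    by left; apply: mono.
  by right; apply: mono.
Qed.
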